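(* Let $A=\{1\text{-}32\text{-}4,\ 1\text{-}42\text{-}3,\ 2\text{-}31\text{-}4,\ 2\text{-}41\text{-}3\}$ and $B=\{1\text{-}3\text{-}2\text{-}4,\ 1\text{-}4\text{-}2\text{-}3,\ 2\text{-}3\text{-}1\text{-}4,\ 2\text{-}4\text{-}1\text{-}3\}$ be sets of (dashed) patterns. For $n\ge 1$ let $a_n=|\mathrm{Av}_n(B)|$ be the number of permutations of length $n$ avoiding all patterns in $B$. Then $a_1=1$, $a_2=2$, and $a_n=4a_{n-1}-2a_{n-2}$ for all $n\ge 3$. The same holds with $A$ in place of $B$: the numbers $|\mathrm{Av}_n(A)|$ satisfy $|\mathrm{Av}_1(A)|=1$, $|\mathrm{Av}_2(A)|=2$, and $|\mathrm{Av}_n(A)|=4|\mathrm{Av}_{n-1}(A)|-2|\mathrm{Av}_{n-2}(A)|$ for all $n\ge 3$.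
   Context: A permutation of length $n$ is written in one-line notation $\sigma_1\sigma_2\cdots\sigma_n$, a rearrangement of $1,\dots,n$. A (dashed, generalized) pattern is a permutation $\pi_1\cdots\pi_k$ in which some or all of the adjacent elements may be separated by dashes. A subsequence $\sigma_{i_1}\sigma_{i_2}\cdots\sigma_{i_k}$ (with $i_1<i_2<\cdots<i_k$) of a permutation $\sigma$ is an occurrence of the pattern if (i) its elements have the same relative order as $\pi_1,\dots,\pi_k$ (i.e. $\sigma_{i_s}<\sigma_{i_t}$ if and only if $\pi_s<\pi_t$), and (ii) whenever there is no dash between the $j$th and $(j+1)$th elements of the pattern, the $j$th and $(j+1)$th elements of the subsequence occur consecutively in $\sigma$ (i.e. $i_{j+1}=i_j+1$). Where there is a dash, the corresponding elements may or may not be consecutive in $\sigma$. A permutation avoids a pattern if it contains no occurrence of it, and avoids a set of patterns if it contains no occurrence of any pattern in the set. For a set $S$ of patterns, $\mathrm{Av}_n(S)$ denotes the set of all permutations of length $n$ that avoid $S$. *)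

(* Defs.v *)
From mathcomp Require Import all_boot perm.

Set Implicit Arguments.
Unset Strict Implicit.
Unset Printing Implicit Defensive.

(* A dashed pattern is given by its maximal dash-free blocks, e.g. 1-32-4 is
   [:: [:: 1]; [:: 3; 2]; [:: 4]]. *)
Record dashed_pattern := DashedPattern {
  blocks : seq (seq nat);
  blocks_neq0 : [::] \notin blocks;
  blocks_perm : perm_eq (flatten blocks) (iota 1 (size (flatten blocks)))
}.

Definition letters (p : dashed_pattern) : seq nat := flatten (blocks p).

Definition psize (p : dashed_pattern) : nat := size (letters p).

(* For j.+1 < psize p: there is a dash between the letters at the 0-based
   positions j and j.+1, i.e. these two letters lie in different blocks. *)
Definition dash_after (p : dashed_pattern) (j : nat) : bool :=
  reshape_index (shape (blocks p)) j != reshape_index (shape (blocks p)) j.+1.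

(* Permutations of length n act on {0, ..., n-1} instead of {1, ..., n}; only
   the relative order of their values matters. *)
Definition occurrence (n : nat) (s : 'S_n) (p : dashed_pattern)
    (i : {ffun 'I_(psize p) -> 'I_n}) : bool :=
  [&& [forall a : 'I_(psize p), forall b : 'I_(psize p),
         (a < b) ==> (i a < i b)],
      [forall a : 'I_(psize p), forall b : 'I_(psize p),
         (s (i a) < s (i b)) == (nth 0 (letters p) a < nth 0 (letters p) b)]
    & [forall a : 'I_(psize p), forall b : 'I_(psize p),
         (b == a.+1 :> nat) && ~~ dash_after p a ==> (i b == (i a).+1 :> nat)]].

Definition contains (n : nat) (s : 'S_n) (p : dashed_pattern) : bool :=
  [exists i : {ffun 'I_(psize p) -> 'I_n}, occurrence s i].

Definition Av (n : nat) (S : seq dashed_pattern) : {set 'S_n} :=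
  [set s : 'S_n | all (fun p => ~~ contains s p) S].

Definition patternsA : seq dashed_pattern :=
  [:: @DashedPattern [:: [:: 1]; [:: 3; 2]; [:: 4]] isT isT;
      @DashedPattern [:: [:: 1]; [:: 4; 2]; [:: 3]] isT isT;
      @DashedPattern [:: [:: 2]; [:: 3; 1]; [:: 4]] isT isT;
      @DashedPattern [:: [:: 2]; [:: 4; 1]; [:: 3]] isT isT].

Definition patternsB : seq dashed_pattern :=
  [:: @DashedPattern [:: [:: 1]; [:: 3]; [:: 2]; [:: 4]] isT isT;
      @DashedPattern [:: [:: 1]; [:: 4]; [:: 2]; [:: 3]] isT isT;
      @DashedPattern [:: [:: 2]; [:: 3]; [:: 1]; [:: 4]] isT isT;
      @DashedPattern [:: [:: 2]; [:: 4]; [:: 1]; [:: 3]] isT isT].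

(* Main.v *)
(* The four patterns of B are the ones whose letters at places 1 and 3 are both
   smaller than the letters at places 2 and 4. So s contains one of them iff, for
   some threshold k, the word recording which s x are < k (low) or >= k (high)
   has low high low high as a subsequence. In such a subsequence the middle
   high...low can be taken adjacent, whence A and B are equivalent.
   Hence s avoids B iff all its words have the form H^p L^q H^r L^m. Listing the
   words for k = 0, 1, ..., n turns one H into L at a time, and the number of ways
   to finish depends on p and r only: with t(p, r) this number,
     t(p, r) = t(p-1, r) + 2 t(p, r-1)   (r > 1; without the factor 2 if r = 1;
                                          without the first term if p = 0),
     t(0, 0) = 1,  t(p, 0) = \sum_(i + j = p-1) t(i, j)   (p > 0),
   and summing over an antidiagonal p + r = k gives the linear recurrence for
   a_n = t(n, 0). *)
Require Import Defs.
From mathcomp Require Import all_boot all_algebra perm.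
From mathcomp Require Import zify.

Set Implicit Arguments.
Unset Strict Implicit.
Unset Printing Implicit Defensive.

(** * The numbers t(p, r) and their linear recurrence *)

(* [completion_number (p + r) r] is the number t(p, r) of the header. *)
Fixpoint completion_number (k r : nat) : nat :=
  if k is k'.+1 then
    if r is r'.+1 then
      (if r <= k' then completion_number k' r else 0) + (if r' == 0 then 1 else 2) * completion_number k' r'
    else \sum_(b < k) completion_number k' b
  else 1.

(** Expanding the row of [k.+1] over the row of [k] counts an entry with r > 0 three times and the
    entry r = 0 once. Together with the leading [completion_number k.+1 0], this is four row sums
    less twice the entry r = 0. *)
Lemma completion_number_rec k : completion_number k.+2 0 + 2 * completion_number k 0 = 4 * completion_number k.+1 0.
Proof.
have -> : completion_number k.+2 0 = completion_number k.+1 0 + \sum_(b < k.+1) completion_number k.+1 b.+1.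
  by rewrite -(big_ord_recl k.+1 (completion_number k.+1)).
have S1 : completion_number k.+1 0 = \sum_(b < k.+1) completion_number k b by [].
rewrite [X in _ + X + _](eq_bigr (fun b : 'I_k.+1 =>
  (if b < k then completion_number k b.+1 else 0) + (if b == 0 :> nat then 1 else 2) * completion_number k b)) // big_split /=.
have S2 : completion_number k.+1 0 = completion_number k 0 + \sum_(b < k) completion_number k b.+1.
  by rewrite S1 big_ord_recl.
have -> : \sum_(b < k.+1) (if b < k then completion_number k b.+1 else 0) = \sum_(b < k) completion_number k b.+1.
  by rewrite big_ord_recr /= ltnn addn0; apply: eq_bigr => b _; rewrite ltn_ord.
have -> : \sum_(b < k.+1) (if b == 0 :> nat then 1 else 2) * completion_number k b =
    completion_number k 0 + 2 * \sum_(b < k) completion_number k b.+1.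
  by rewrite big_ord_recl mul1n big_distrr.
rewrite -S1 {}S2; move: (completion_number k 0) (\sum_(b < k) _) => u v.
lia.
Qed.

(** * Good words and their completions *)

Definition low_high_low_high n (L : {set 'I_n}) (a b c d : 'I_n) : bool :=
  [&& a < b, b < c, c < d, a \in L, b \notin L, c \in L & d \notin L].

Definition good n (L : {set 'I_n}) : bool :=
  [forall a, forall b, forall c, forall d, ~~ low_high_low_high L a b c d].

Lemma goodP n (L : {set 'I_n}) :
  reflect (forall a b c d, ~~ low_high_low_high L a b c d) (good L).
Proof.
apply: (iffP idP) => [H a b c d | H].
  by move: H => /forallP/(_ a)/forallP/(_ b)/forallP/(_ c)/forallP/(_ d).
by apply/forallP=> a; apply/forallP=> b; apply/forallP=> c; apply/forallP=> d.
Qed.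

(* For k = #|~: L|, the number of ways to fill up L one point at a time while
   staying good. *)
Fixpoint completions n (k : nat) (L : {set 'I_n}) : nat :=
  if k is k'.+1 then
    \sum_(x | (x \notin L) && good (x |: L)) completions k' (x |: L)
  else 1.

(* The indicator word of L is H^p L^q H^r L^m; q > 0 makes p and r unique when
   r > 0, while q = 0 is allowed for r = 0 so as to cover the empty L. *)
Definition two_block n (p q r : nat) (L : {set 'I_n}) : Prop :=
  [/\ p + q + r <= n, (0 < r -> 0 < q) &
      forall x : 'I_n, (x \in L) = (p <= x < p + q) || (p + q + r <= x)].

Lemma two_block_good n p q r (L : {set 'I_n}) : two_block p q r L -> good L.
Proof.
case=> _ _ HL; apply/goodP=> a b c d; rewrite /low_high_low_high !HL.
lia.
Qed.

Lemma two_block_step n p q r (L : {set 'I_n}) (x : 'I_n) :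
  two_block p q r L -> 0 < r ->
  ((x \notin L) && good (x |: L)) =
  [|| x.+1 == p, x == p + q :> nat | x.+1 == p + q + r].
Proof.
move=> [le_n + HL] r0 => /(_ r0) q0.
have [xp|/negP xp] := boolP [|| x.+1 == p, x == p + q :> nat | x.+1 == p + q + r].
  apply/andP; split; first by rewrite HL; lia.
  by apply/goodP=> a b c d; rewrite /low_high_low_high !inE !HL -!val_eqE /=; lia.
apply/negP=> /andP[xL /goodP gx]; rewrite HL in xL.
have ord m : m < n -> exists y : 'I_n, y = m :> nat by move=> h; exists (Ordinal h).
have [ap Eap] := ord p ltac:(lia).
have [a2 Ea2] := ord (p + q) ltac:(lia).
(* Lowering x before the end of the first H block creates the forbidden word at x, p-1, p, p+q;
   lowering x strictly inside the second creates it at p, p+q, x, p+q+r-1. *)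
case: (ltnP x p) => xlp.
  have [a1 Ea1] := ord p.-1 ltac:(lia).
  by move: (gx x a1 ap a2); rewrite /low_high_low_high !inE !HL -!val_eqE /=; lia.
have [a3 Ea3] := ord (p + q + r).-1 ltac:(lia).
by move: (gx ap a2 x a3); rewrite /low_high_low_high !inE !HL -!val_eqE /=; lia.
Qed.

Lemma completions_two_block n k p q r (L : {set 'I_n}) :
  two_block p q r L -> p + r = k -> completions k L = completion_number k r.
Proof.
elim: k p q r L => [|k IH] p q r L //= blk Ek.
have [le_n q0 HL] := blk.
case: r => [|r] in blk Ek le_n q0 HL *.
  (* There is only one H block, and lowering any x in it leaves H^x L H^(k-x). *)
  have Ep : p = k.+1 by lia.
  rewrite (eq_bigl (fun x : 'I_n => x < k.+1)) => [|x]; last first.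
    have [xk|xk] := ltnP x k.+1; last by rewrite HL; lia.
    rewrite HL; apply/andP; split; first lia.
    apply: (@two_block_good _ x 1 (k - x)).
    by split; [lia | lia | move=> y; rewrite !inE HL -val_eqE /=; lia].
  rewrite (eq_bigr (fun x : 'I_n => completion_number k (k - x))) => [|x xk]; last first.
    apply: (IH x 1) => //; last lia.
    by split; [lia | lia | move=> y; rewrite !inE HL -val_eqE /=; lia].
  have le_k : k.+1 <= n by lia.
  rewrite (big_ord_narrow le_k) /= (reindex_inj rev_ord_inj) /=.
  by apply: eq_bigr => i _; congr completion_number; have := ltn_ord i; lia.
have {}q0 := q0 isT.
rewrite (eq_bigl _ _ (fun x => two_block_step x blk isT)).
rewrite (bigID (fun x : 'I_n => x.+1 == p)) /=; congr (_ + _).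
  transitivity (\sum_(x < n | x == p.-1 :> nat) if 0 < p then completion_number k r.+1 else 0).
    case: (posnP p) => [p0 | p0].
      by rewrite big1_eq big1 // => x; lia.
    apply: eq_big => x; first lia.
    move=> Hx; apply: (IH p.-1 q.+1) => //; last lia.
    by split; [lia | lia | move=> y; rewrite !inE HL -val_eqE /=; lia].
  rewrite (big_ord1_eq _ (fun=> _)) (_ : (r < k) = (0 < p)); last lia.
  by case: ifP => p0; rewrite ?if_same // ifT //; lia.
(* The two ends of the second H block, now of length [r.+1], both lead to t(p, r); they coincide
   when [r] is 0, so the factor 2 drops to 1. *)
transitivity (\sum_(x < n | (x == p + q :> nat) || (x == p + q + r :> nat)) completion_number k r).
  apply: eq_big => x; first lia.
  move=> Hx; have [xpq|xpq] := eqVneq (x : nat) (p + q).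
    apply: (IH p q.+1) => //; last lia.
    by split; [lia | lia | move=> y; rewrite !inE HL -val_eqE /=; lia].
  apply: (IH p q) => //; last lia.
  by split; [lia | lia | move=> y; rewrite !inE HL -val_eqE /=; lia].
rewrite (bigID (fun x : 'I_n => x == p + q :> nat)) /=.
rewrite (eq_bigl (fun x : 'I_n => x == p + q :> nat)) => [|x]; last lia.
rewrite (big_ord1_eq _ (fun=> _)) ifT; last lia.
case: eqVneq => [->|r0].
  by rewrite big1 ?mul1n ?addn0 // => x; lia.
rewrite (eq_bigl (fun x : 'I_n => x == p + q + r :> nat)) => [|x]; last lia.
by rewrite (big_ord1_eq _ (fun=> _)) ifT; [rewrite mul2n addnn | lia].
Qed.

(** * Permutations as chains of sublevel sets *)

Definition sublevel n (s : 'S_n) (k : nat) : {set 'I_n} := [set x | s x < k].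

Definition agree n (j : nat) (s0 s : 'S_n) : bool :=
  [forall x, (s0 x < j) ==> (s x == s0 x)].

Definition good_chain n (s : 'S_n) : bool :=
  [forall k : 'I_n.+1, good (sublevel s k)].

Lemma agree_sublevel n j (s0 s : 'S_n) i :
  agree j s0 s -> i <= j -> sublevel s i = sublevel s0 i.
Proof.
move=> /forallP ag ij; apply/setP=> y; rewrite !inE.
apply/idP/idP=> [sy | s0y].
  have /implyP := ag (s0^-1%g (s y)); rewrite permKV => /(_ (leq_trans sy ij))/eqP/perm_inj E.
  by rewrite -{1}E permKV.
by have /implyP/(_ (leq_trans s0y ij))/eqP -> := ag y.
Qed.

Lemma agreeS n (j : 'I_n) (s0 s : 'S_n) (x : 'I_n) :
  s0 x = j -> agree j.+1 s0 s = agree j s0 s && (s^-1%g j == x).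
Proof.
move=> sx; apply/forallP/andP=> [ag | [/forallP ag /eqP E] y].
  split; last by have := ag x; rewrite sx ltnSn => /eqP <-; rewrite permK.
  by apply/forallP=> y; apply/implyP=> yj; have /implyP := ag y; apply; apply: ltnW.
apply/implyP; rewrite ltnS leq_eqVlt => /orP[/eqP yj | yj]; last by have /implyP/(_ yj) := ag y.
have <- : x = y by apply: (@perm_inj _ s0); apply: val_inj; rewrite sx /= yj.
by rewrite sx -E permKV.
Qed.

(** Induction on the number [k] of values still to be placed: the permutations are sorted by the
    place x of the value [j], which amounts to adding x to the sublevel set. *)
Lemma card_agree n k j (s0 : 'S_n) :
  j + k = n -> (forall i, i <= j -> good (sublevel s0 i)) ->
  #|[set s : 'S_n | good_chain s && agree j s0 s]| =
  completions k (sublevel s0 j).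
Proof.
elim: k j s0 => [|k IH] j s0 jk g0 /=.
  rewrite -(cards1 s0); apply: eq_card => s; rewrite !inE.
  apply/andP/eqP=> [[_ /forallP ag] | ->].
    apply/permP=> x; have /implyP/(_ _)/eqP -> // := ag x.
    by have := ltn_ord (s0 x); lia.
  split; apply/forallP=> x; last by rewrite eqxx implybT.
  by apply: g0; have := ltn_ord x; lia.
have jn : j < n by lia.
pose jo := Ordinal jn.
rewrite -sum1_card (partition_big (fun s : 'S_n => s^-1%g jo) predT) //=.
rewrite [RHS]big_mkcond /=; apply: eq_bigr => x _; rewrite sum1_card.
case: ifP => [/andP[xL gx] | Hx]; last first.
  apply: eq_card0 => s; apply/negP; rewrite unfold_in /= inE; case/andP=> /andP[/forallP gs ag] /eqP sx.
  have Esx : s x = jo by rewrite -sx permKV.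
  move: Hx; rewrite -(agree_sublevel (i := j) ag) // inE Esx ltnn /=.
  suff -> : x |: sublevel s j = sublevel s j.+1.
    by have := gs (inord j.+1); rewrite inordK // => ->.
  apply/setP=> y; rewrite !inE ltnS [s y <= j]leq_eqVlt; congr (_ || _).
  by rewrite -(inj_eq (@perm_inj _ s)) Esx -val_eqE.
(* s1 extends the common part of s0 by sending x to j. *)
pose s1 := (tperm x (s0^-1 jo) * s0)%g.
have s1x : s1 x = jo by rewrite permM tpermL permKV.
have ag1 : agree j s0 s1.
  apply/forallP=> y; apply/implyP=> yj; rewrite permM tpermD //.
    by apply: contraNneq xL => ->; rewrite inE.
  by apply/eqP=> E; move: yj; rewrite -E permKV ltnn.
have L1 : sublevel s1 j = sublevel s0 j by apply: agree_sublevel ag1 _.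
have L1S : sublevel s1 j.+1 = x |: sublevel s0 j.
  rewrite -L1; apply/setP=> y; rewrite !inE ltnS [s1 y <= j]leq_eqVlt; congr (_ || _).
  by rewrite -(inj_eq (@perm_inj _ s1)) s1x -val_eqE.
rewrite -L1S -IH; first last.
- move=> i; rewrite leq_eqVlt => /orP[/eqP -> | ij]; first by rewrite L1S.
  by rewrite (agree_sublevel (i := i) ag1) // g0.
- by rewrite addSnnS.
apply: eq_card => s; rewrite unfold_in !inE /= (agreeS (j := jo) s s1x) andbA; congr (_ && _ && _).
(* [s0] and [s1] have the same points of value below [j] and coincide there. *)
apply/forallP/forallP=> ag y; apply/implyP.
  move=> yj; have ys0 : s0 y < j.
    by have : y \in sublevel s1 j by [rewrite inE]; rewrite L1 inE.
  have /forallP/(_ y)/implyP/(_ ys0)/eqP -> := ag1.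
  by have /implyP/(_ ys0) := ag y.
move=> yj; have /forallP/(_ y)/implyP/(_ yj)/eqP E := ag1.
by have := ag y; rewrite E yj.
Qed.

(** The chain starts at the word H^n, where [agree 0] is no constraint; the identity serves as base
    permutation. *)
Lemma card_good_chain n : #|[set s : 'S_n | good_chain s]| = completion_number n 0.
Proof.
have E0 : sublevel (1%g : 'S_n) 0 = set0 by apply/setP=> x; rewrite !inE.
have gb : two_block n 0 0 (set0 : {set 'I_n}).
  by split => //; [lia | move=> x; rewrite inE; have := ltn_ord x; lia].
rewrite -(completions_two_block gb) ?addn0 // -E0 -card_agree //.
  apply: eq_card => s; rewrite !inE; case: good_chain => //=.
  by apply/esym/forallP.
by move=> i; rewrite leqn0 => /eqP ->; rewrite E0; apply: two_block_good gb.
Qed.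

(** * Pattern occurrences and alternations *)

Lemma contains_intro n (s : 'S_n) (p : dashed_pattern) (i : nat -> 'I_n) :
  (forall a b, a < b < psize p -> i a < i b) ->
  (forall a b, a < psize p -> b < psize p ->
     (s (i a) < s (i b)) = (nth 0 (letters p) a < nth 0 (letters p) b)) ->
  (forall a, a.+1 < psize p -> ~~ dash_after p a -> i a.+1 = (i a).+1 :> nat) ->
  contains s p.
Proof.
move=> inc ord adj; apply/existsP; exists [ffun a : 'I_(psize p) => i a].
apply/and3P; split; apply/forallP=> a; apply/forallP=> b; rewrite !ffunE.
- by apply/implyP=> ab; apply: inc; rewrite ab /=.
- by apply/eqP; apply: ord.
- by apply/implyP=> /andP[/eqP Eb nd]; rewrite Eb adj // -Eb.
Qed.

Lemma contains_elim n (s : 'S_n) (p : dashed_pattern) : contains s p ->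
  exists i : 'I_(psize p) -> 'I_n, (forall a b : 'I_(psize p), a < b -> i a < i b) /\
    (forall a b : 'I_(psize p), (s (i a) < s (i b)) = (nth 0 (letters p) a < nth 0 (letters p) b)).
Proof.
move=> /existsP[i /and3P[/forallP inc /forallP ord _]]; exists i; split=> a b.
  by move=> ab; have /forallP/(_ b)/implyP := inc a; apply.
by have /forallP/(_ b)/eqP := ord a.
Qed.

Definition alternation n (s : 'S_n) (a b c d : 'I_n) : bool :=
  [&& a < b, b < c, c < d, maxn (s a) (s c) < s b & maxn (s a) (s c) < s d].

Definition odd_places_small (p : dashed_pattern) : bool :=
  let w := letters p in
  (psize p == 4) && (maxn (nth 0 w 0) (nth 0 w 2) < minn (nth 0 w 1) (nth 0 w 3)).

Lemma contains_alternation n (s : 'S_n) p : odd_places_small p -> contains s p ->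
  exists a b c d, alternation s a b c d.
Proof.
move=> /andP[/eqP p4 sb] /contains_elim[i [inc ord]].
have lt j : j < 4 -> j < psize p by rewrite p4.
pose o j (h : j < 4) := i (Ordinal (lt j h)).
exists (o 0 isT), (o 1 isT), (o 2 isT), (o 3 isT).
rewrite /alternation !gtn_max !ord /= !inc //=.
lia.
Qed.

Lemma alternation_adjacent n (s : 'S_n) a b c d : alternation s a b c d ->
  exists b' c' : 'I_n, c' = b'.+1 :> nat /\ alternation s a b' c' d.
Proof.
move=> /and5P[ab bc cd acb acd].
(* Extended by [false] beyond [n], so that a maximum over natural numbers can be taken. *)
pose P j := if insub j is Some x then maxn (s a) (s c) < s (x : 'I_n) else false.
have PE (x : 'I_n) : P x = (maxn (s a) (s c) < s x) by rewrite /P valK.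
have exP : exists j, (b <= j < c) && P j by exists b; rewrite leqnn bc PE.
have [|m /andP[/andP[bm mc] Pm] maxm] := ex_maxnP exP (m := c).
  by move=> j /andP[/andP[_ /ltnW]].
have ltc := ltn_ord c.
have mn : m < n by lia.
have m1n : m.+1 < n by lia.
(* m is the last high position before c. *)
exists (Ordinal mn), (Ordinal m1n); split=> //.
have := PE (Ordinal mn); rewrite /= Pm => /esym lt_m.
(* The successor of m is not high, so putting it in place of c does not raise the threshold. *)
have nP : ~~ (maxn (s a) (s c) < s (Ordinal m1n)).
  rewrite -PE /=; have [Em | nEm] := eqVneq m.+1 c; first by rewrite Em PE; lia.
  by apply/negP=> Pm1; have := maxm m.+1; rewrite Pm1 andbT; lia.
have m1c : m.+1 <= c by lia.
by rewrite /alternation /=; lia.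
Qed.

(** The alternation settles every comparison between a small and a large letter, leaving one
    comparison within each pair. The last hypothesis allows a missing dash only in the middle, which
    covers both A and B. *)
Lemma alternation_contains n (s : 'S_n) p a b c d :
  alternation s a b c d -> odd_places_small p ->
  (s a < s c) = (nth 0 (letters p) 0 < nth 0 (letters p) 2) ->
  (s b < s d) = (nth 0 (letters p) 1 < nth 0 (letters p) 3) ->
  (forall j, j < 3 -> ~~ dash_after p j -> j = 1 /\ c = b.+1 :> nat) ->
  contains s p.
Proof.
move=> pv /andP[/eqP p4 sb] ac bd adj.
have /and5P[ab bc cd acb acd] := pv.
have neq j k : j < 4 -> k < 4 -> j != k -> nth 0 (letters p) j != nth 0 (letters p) k.
  move=> j4 k4; rewrite nth_uniq ?[size _]p4 //.
  by rewrite /letters (perm_uniq (blocks_perm p)) iota_uniq.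
have w02 := neq 0 2 isT isT isT; have w13 := neq 1 3 isT isT isT.
have sinj (x y : 'I_n) : x < y -> s x != s y :> nat.
  by move=> xy; rewrite (inj_eq val_inj) (inj_eq perm_inj) -val_eqE neq_ltn xy.
have sac := sinj a c (ltn_trans ab bc); have sbd := sinj b d (ltn_trans bc cd).
apply: (@contains_intro _ _ _ (nth a [:: a; b; c; d])); rewrite p4.
- by case=> [|[|[|[|?]]]] [|[|[|[|?]]]] //=; lia.
- by case=> [|[|[|[|?]]]] [|[|[|[|?]]]] //= _ _; lia.
- by move=> j j3 /(adj _ j3)[-> ->].
Qed.

Lemma AvB_alternationP n (s : 'S_n) :
  reflect (forall a b c d, ~~ alternation s a b c d) (s \in Av n patternsB).
Proof.
rewrite inE /=; apply: (iffP and5P) => [[n1 n2 n3 n4 _] a b c d | npv]; last first.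
  by split=> //; apply/negP=> /contains_alternation[] // a [b [c [d]]]; apply/negP.
apply/negP=> pv; have ct p := @alternation_contains n s p a b c d pv.
(* The two comparisons select 1324, 1423, 2314 or 2413, in this order. *)
case ac: (s a < s c); case bd: (s b < s d).
- by apply: (negP n1); apply: ct => // -[|[|[|?]]].
- by apply: (negP n2); apply: ct => // -[|[|[|?]]].
- by apply: (negP n3); apply: ct => // -[|[|[|?]]].
- by apply: (negP n4); apply: ct => // -[|[|[|?]]].
Qed.

Lemma AvA_alternationP n (s : 'S_n) :
  reflect (forall a b c d, ~~ alternation s a b c d) (s \in Av n patternsA).
Proof.
rewrite inE /=; apply: (iffP and5P) => [[n1 n2 n3 n4 _] a b c d | npv]; last first.
  by split=> //; apply/negP=> /contains_alternation[] // a [b [c [d]]]; apply/negP.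
apply/negP=> /alternation_adjacent[{}b [{}c [Ec pv]]].
have ct p := @alternation_contains n s p a b c d pv.
case ac: (s a < s c); case bd: (s b < s d).
- by apply: (negP n1); apply: ct => // -[|[|[|?]]].
- by apply: (negP n2); apply: ct => // -[|[|[|?]]].
- by apply: (negP n3); apply: ct => // -[|[|[|?]]].
- by apply: (negP n4); apply: ct => // -[|[|[|?]]].
Qed.

Lemma good_chainP n (s : 'S_n) :
  reflect (forall a b c d, ~~ alternation s a b c d) (good_chain s).
Proof.
apply: (iffP forallP) => [gs a b c d | npv k].
  (* The threshold just above the two low values makes a and c low, b and d high. *)
  apply/negP=> pv; have lt : (maxn (s a) (s c)).+1 < n.+1.
    by rewrite ltnS gtn_max !ltn_ord.
  have /goodP/(_ a b c d) := gs (Ordinal lt).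
  by move: pv; rewrite /alternation /low_high_low_high !inE /=; lia.
apply/goodP=> a b c d; have := npv a b c d.
by rewrite /alternation /low_high_low_high !inE; lia.
Qed.

(** * The two cardinalities and the recurrence *)

Lemma card_AvB n : #|Av n patternsB| = completion_number n 0.
Proof.
rewrite -card_good_chain; apply: eq_card => s; rewrite [RHS]inE.
exact/AvB_alternationP/good_chainP.
Qed.

Lemma card_AvA n : #|Av n patternsA| = completion_number n 0.
Proof.
rewrite -card_good_chain; apply: eq_card => s; rewrite [RHS]inE.
exact/AvA_alternationP/good_chainP.
Qed.

Local Open Scope ring_scope.

Theorem proposition2 :
  [/\ #|Av 1 patternsB| = 1%N,
      #|Av 2 patternsB| = 2%N &
      forall n : nat, (3 <= n)%N ->
        #|Av n patternsB|%:Z = 4 * #|Av (n - 1) patternsB|%:Z - 2 * #|Av (n - 2) patternsB|%:Z]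
  /\
  [/\ #|Av 1 patternsA| = 1%N,
      #|Av 2 patternsA| = 2%N &
      forall n : nat, (3 <= n)%N ->
        #|Av n patternsA|%:Z = 4 * #|Av (n - 1) patternsA|%:Z - 2 * #|Av (n - 2) patternsA|%:Z].
Proof.
have t1 : completion_number 1 0 = 1%N by rewrite /= big_ord1.
have t2 : completion_number 2 0 = 2%N by have := completion_number_rec 0; rewrite t1 /=; lia.
have rec n : (3 <= n)%N ->
    (completion_number n 0)%:Z = 4 * (completion_number (n - 1) 0)%:Z - 2 * (completion_number (n - 2) 0)%:Z.
  case: n => [|[|n]] // _; rewrite !subSS !subn0.
  by have := completion_number_rec n; lia.
by split; split=> [||n n3]; rewrite ?card_AvA ?card_AvB // rec.
Qed.
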